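(* Let $(\alpha_n)_{n\ge 0}$ and $(\gamma_n)_{n\ge 0}$ be real sequences with $\alpha_0=0$, and let $(p_n)_{n\ge 0}$ be the real polynomials satisfying $$x p_n(x)=\gamma_n p_{n+1}(x)+\alpha_n p_{n-1}(x),\qquad n\ge 0,$$ where $p_{-1}=0$ and $p_0=1$. Assume that: (a) the sequence $(\alpha_n)_{n\ge 0}$ is strictly increasing and $\alpha_n\le \frac12$ for all $n\ge 0$; (b) the sequence $(\gamma_n)_{n\ge 0}$ is positive and strictly decreasing; (c) $\alpha_n+\gamma_n\le 1$ for all $n\ge 0$. Assume also that $$\frac{\alpha_n-\alpha_{n-1}}{\alpha_n\gamma_{n-1}-\alpha_{n-1}\gamma_n}\le \frac{\alpha_{n+1}\gamma_n-\alpha_n\gamma_{n+1}}{\gamma_n-\gamma_{n+1}}\quad\text{for all } n\ge 1,$$ and $$\gamma_0-\gamma_1\le \alpha_1\gamma_0^2.$$ Then for $P_n(x)=\dfrac{p_n(x)}{p_n(1)}$ we have $$P_n(x)^2-P_{n-1}(x)P_{n+1}(x)\ge 0\qquad\text{for all } n\ge 1 \text{ and all } x\in[-1,1].$$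
   Context: Since $\gamma_n\ne 0$ for all $n$, the recurrence together with $p_{-1}=0$, $p_0=1$ determines the polynomials $p_n$ uniquely. The values $p_n(1)$ are positive under the stated hypotheses, so $P_n$ is well defined. *)

(* Defs.v *)
From HB Require Import structures.
From mathcomp Require Import all_boot all_order all_algebra.
From mathcomp Require Import reals sequences.
Set Implicit Arguments.
Unset Strict Implicit.
Unset Printing Implicit Defensive.
Import Order.TTheory GRing.Theory Num.Theory.
Local Open Scope ring_scope.

(* The convention p_{-1} = 0: [shift_poly p n] stands for p_{n-1}. *)
Definition shift_poly (R : realType) (p : nat -> {poly R}) (n : nat) :
    {poly R} :=
  if n is m.+1 then p m else 0.

Definition recurrence_polys (R : realType) (alpha gamma : nat -> R)
    (p : nat -> {poly R}) : Prop :=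
  p 0%N = 1 /\
  forall n : nat,
    'X * p n = gamma n *: p n.+1 + alpha n *: shift_poly p n.

Definition normalized (R : realType) (p : nat -> {poly R}) (n : nat) (x : R) :
    R :=
  (p n).[x] / (p n).[1].

(* Main.v *)
Require Import Defs.
From HB Require Import structures.
From mathcomp Require Import all_boot all_order all_algebra.
From mathcomp Require Import reals sequences.
From mathcomp Require Import ring lra.
Set Implicit Arguments.
Unset Strict Implicit.
Unset Printing Implicit Defensive.
Import Order.TTheory GRing.Theory Num.Theory.
Local Open Scope ring_scope.

(** The normalized polynomials P_n satisfy x P_n = c_n P_(n+1) + a_n P_(n-1)
    with a_n + c_n = 1, because P_n(1) = 1.  In terms of the ratios
    g_n = p_(n+1)(1) / p_n(1) the coefficients are a_n = alpha_n / g_(n-1)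
    and c_n = gamma_n g_n.  If a_n is nonnegative, nondecreasing and at most
    1/2, the Turan determinant is nonnegative on [-1,1] ([turan_ge0]): where
    P_n^2 >= P_(n-1)^2 this is a fact about a single quadratic form, and
    elsewhere c_n times the determinant of index n is at least a_(n-1) times
    the preceding one.  For n = 1 it is a_1 (1 - x^2) / c_1.

    It remains to control a_n.  The values p_n(1) are nondecreasing,
    since alpha_n + gamma_n <= 1 ([values_at1_incr]); hence g_n >= 1 and
    a_n <= alpha_n <= 1/2.  As alpha increases, a_n is nondecreasing as soon as
    g is nonincreasing ([ratios_nonincr]).

    To compare g_(n+1) with g_n, observe that the point (1 / g_n, g_(n+1)) lies
    on the line L_(n+1) : alpha_(n+1) s + gamma_(n+1) t = 1.  The lines L_n and
    L_(n+1) meet at the point (s, t) with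
      s = (gamma_n - gamma_(n+1)) / W_n,  t = (alpha_(n+1) - alpha_n) / W_n,
    where W_n = alpha_(n+1) gamma_n - alpha_n gamma_(n+1).  The hypothesis on
    quotients says that the t of one meeting point is at most 1 / s for the
    next one, which propagates by induction the bound g_n <= 1 / s
    ([ratio_le_quotient]); the condition on gamma_0 - gamma_1 is the case n = 0,
    where g_0 = 1 / gamma_0.  Beyond the meeting point L_(n+1) runs below L_n,
    so alpha_n / g_n + gamma_n g_(n+1) <= 1; comparing this with
    alpha_n / g_(n-1) + gamma_n g_n = 1 carries g_n <= g_(n-1) over to
    g_(n+1) <= g_n. *)

(** * Turan's inequality for recurrences normalized at 1 *)

(** Writing s, t for the absolute values of u, v, the form is bounded below by
    (t - s) ((1 - a) t - a s), a product of nonnegative factors. *)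
Lemma quadratic_form_ge0 (R : realFieldType) (a x u v : R) :
  a <= 1 / 2 -> `|x| <= 1 -> `|u| <= `|v| ->
  0 <= a * u ^+ 2 + (1 - a) * v ^+ 2 - x * (u * v).
Proof.
move=> a_half x_le1 le_uv.
have cross : x * (u * v) <= `|u| * `|v|.
  apply: le_trans (ler_norm _) _.
  by rewrite -[leRHS]normrM [leLHS]normrM ler_piMl.
rewrite -(real_normK (num_real u)) -(real_normK (num_real v)).
have le_cv : a * `|u| <= (1 - a) * `|v|.
  by have := normr_ge0 u; have := normr_ge0 v; nra.
by nra.
Qed.

(** The sequence [a] carries a shift: [a n] is the coefficient a_(n+1) of the
    overview, a_0 = 0 being encoded by [u 1 = x * u 0]. *)
Lemma turan_ge0 (R : realFieldType) (a u : nat -> R) (x : R) :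
  (forall n, 0 <= a n) -> (forall n, a n <= a n.+1) ->
  (forall n, a n <= 1 / 2) -> `|x| <= 1 -> u 1%N = x * u 0%N ->
  (forall n, x * u n.+1 = (1 - a n) * u n.+2 + a n * u n) ->
  forall n, 0 <= u n.+1 ^+ 2 - u n * u n.+2.
Proof.
move=> a_ge0 a_incr a_half x_le1 u1 u_rec n.
have c_gt0 m : 0 < 1 - a m by have := a_half m; lra.
have turan_form m : (1 - a m) * (u m.+1 ^+ 2 - u m * u m.+2)
    = a m * u m ^+ 2 + (1 - a m) * u m.+1 ^+ 2 - x * (u m * u m.+1).
  have -> : x * (u m * u m.+1) = u m * (x * u m.+1) by ring.
  by rewrite u_rec; ring.
elim: n => [|n IHn].
  rewrite -(pmulr_rge0 _ (c_gt0 0%N)) turan_form u1.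
  have x2_le1 : x ^+ 2 <= 1 by rewrite -real_normK ?num_real ?expr_le1.
  have -> : a 0%N * u 0%N ^+ 2 + (1 - a 0%N) * (x * u 0%N) ^+ 2
            - x * (u 0%N * (x * u 0%N))
          = a 0%N * u 0%N ^+ 2 * (1 - x ^+ 2) by ring.
  by rewrite mulr_ge0 ?subr_ge0 // mulr_ge0 ?sqr_ge0.
rewrite -(pmulr_rge0 _ (c_gt0 n.+1)).
have [le_u|/ltW ge_u] := lerP `|u n.+1| `|u n.+2|.
  by rewrite turan_form quadratic_form_ge0.
(* a_(n+1) P_(n+1)^2 - x P_n P_(n+1) occurs in both forms, so this relation
   between the determinants is free of the cross term. *)
have -> : (1 - a n.+1) * (u n.+2 ^+ 2 - u n.+1 * u n.+3)
    = a n * (u n.+1 ^+ 2 - u n * u n.+2)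
      + (a n.+1 - a n) * (u n.+1 ^+ 2 - u n.+2 ^+ 2).
  have -> : a n * (u n.+1 ^+ 2 - u n * u n.+2)
      = a n * u n.+1 ^+ 2 + (1 - a n) * u n.+2 ^+ 2 - u n.+2 * (x * u n.+1).
    by rewrite u_rec; ring.
  by rewrite turan_form; ring.
apply: addr_ge0; first exact: mulr_ge0.
apply: mulr_ge0; rewrite subr_ge0 //.
by rewrite -(real_normK (num_real (u n.+1))) -(real_normK (num_real (u n.+2)))
  lerXn2r ?nnegrE.
Qed.

(** * Monotonicity of the ratios of values at 1 *)

(** A sequence with the recurrence of the values at 1 grows because
    gamma_n q_(n+1) = q_n - alpha_n q_(n-1) >= (1 - alpha_n) q_n
    >= gamma_n q_n, the first inequality being the induction hypothesis
    q_(n-1) <= q_n. *)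
Lemma values_at1_incr (R : realFieldType) (alpha gamma q : nat -> R) :
  (forall n, 0 <= alpha n) -> (forall n, 0 < gamma n) ->
  (forall n, alpha n + gamma n <= 1) ->
  q 0%N = 1 -> gamma 0%N * q 1%N = 1 ->
  (forall n, q n.+1 = gamma n.+1 * q n.+2 + alpha n.+1 * q n) ->
  forall n, 0 < q n <= q n.+1.
Proof.
move=> alpha_ge0 gamma_gt0 alpha_gamma q0 q1 q_rec.
elim=> [|n /andP[q_gt0 q_le]].
  rewrite q0 ltr01 -(ler_pM2l (gamma_gt0 0%N)) q1 mulr1.
  by have := alpha_gamma 0%N; have := alpha_ge0 0%N; lra.
have qS_gt0 := lt_le_trans q_gt0 q_le.
rewrite qS_gt0 -(ler_pM2l (gamma_gt0 n.+1)).
have := q_rec n; have := alpha_ge0 n.+1; have := alpha_gamma n.+1; nra.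
Qed.

(** If g_n <= 1 / s at the meeting point (s, t) of L_n and L_(n+1), then on
    L_(n+1) the abscissa 1 / g_n is at least s, so the ordinate g_(n+1) is at
    most t, and t is below the bound required of g_(n+1). *)
Lemma ratio_le_quotient (R : realFieldType) (alpha gamma g : nat -> R) :
  alpha 0%N = 0 -> (forall n, alpha n < alpha n.+1) ->
  (forall n, 0 <= alpha n) ->
  (forall n, 0 < gamma n) -> (forall n, gamma n.+1 < gamma n) ->
  (forall n, (alpha n.+1 - alpha n)
      / (alpha n.+1 * gamma n - alpha n * gamma n.+1)
    <= (alpha n.+2 * gamma n.+1 - alpha n.+1 * gamma n.+2)
      / (gamma n.+1 - gamma n.+2)) ->
  gamma 0%N - gamma 1%N <= alpha 1%N * gamma 0%N ^+ 2 ->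
  (forall n, 0 < g n) -> gamma 0%N * g 0%N = 1 ->
  (forall n, gamma n.+1 * g n.+1 + alpha n.+1 / g n = 1) ->
  forall n, g n * (gamma n - gamma n.+1)
    <= alpha n.+1 * gamma n - alpha n * gamma n.+1.
Proof.
move=> alpha0 alpha_lt alpha_ge0 gamma_gt0 gamma_lt quotients initial.
move=> g_gt0 g0 g_rec.
elim=> [|n IHn].
  rewrite alpha0 mul0r subr0 -(ler_pM2l (gamma_gt0 0%N)) mulrA g0 mul1r.
  by have -> : gamma 0%N * (alpha 1%N * gamma 0%N)
    = alpha 1%N * gamma 0%N ^+ 2 by ring.
have d_gt0 : 0 < gamma n.+1 - gamma n.+2 by rewrite subr_gt0.
have W_gt0 : 0 < alpha n.+1 * gamma n - alpha n * gamma n.+1.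
  have := alpha_lt n; have := gamma_lt n; have := alpha_ge0 n.
  by have := gamma_gt0 n.+1; nra.
rewrite -ler_pdivlMr //; apply: le_trans (quotients n).
rewrite ler_pdivlMr // -(ler_pM2l (gamma_gt0 n.+1)) mulrA.
have -> : gamma n.+1 * g n.+1 = 1 - alpha n.+1 / g n.
  by rewrite -(g_rec n) addrK.
move: IHn; rewrite mulrC -ler_pdivlMr // => IHn.
have := ler_wpM2l (alpha_ge0 n.+1) IHn.
rewrite mulrA; set W := _ - alpha n * _; rewrite mulrAC => ?.
rewrite mulrBl mul1r.
have -> : gamma n.+1 * (alpha n.+1 - alpha n)
  = W - alpha n.+1 * (gamma n - gamma n.+1) by rewrite /W; ring.
by rewrite lerD2l lerN2.
Qed.

(** With the convention that alpha_0 / g_(-1) = 0, both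
    alpha_n / g_n + gamma_n g_(n+1) <= 1 and
    alpha_n / g_(n-1) + gamma_n g_n = 1 hold for every n, and the first terms
    are ordered by induction. *)
Lemma ratios_nonincr (R : realFieldType) (alpha gamma g : nat -> R) :
  alpha 0%N = 0 -> (forall n, 0 <= alpha n) -> (forall n, 0 < gamma n) ->
  (forall n, g n * (gamma n - gamma n.+1)
    <= alpha n.+1 * gamma n - alpha n * gamma n.+1) ->
  (forall n, 0 < g n) -> gamma 0%N * g 0%N = 1 ->
  (forall n, gamma n.+1 * g n.+1 + alpha n.+1 / g n = 1) ->
  forall n, g n.+1 <= g n.
Proof.
move=> alpha0 alpha_ge0 gamma_gt0 g_le g_gt0 g0 g_rec.
(* The point (1 / g_n, g_(n+1)) of L_(n+1) lies on or below L_n. *)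
have below n : gamma n * g n.+1 <= 1 - alpha n / g n.
  rewrite -(ler_pM2l (gamma_gt0 n.+1)) mulrCA.
  have -> : gamma n.+1 * g n.+1 = 1 - alpha n.+1 / g n.
    by rewrite -(g_rec n) addrK.
  rewrite -(ler_pM2l (g_gt0 n)).
  have gn0 : g n != 0 by rewrite gt_eqF.
  have -> : g n * (gamma n * (1 - alpha n.+1 / g n))
    = g n * gamma n - gamma n * alpha n.+1 by field.
  have -> : g n * (gamma n.+1 * (1 - alpha n / g n))
    = g n * gamma n.+1 - gamma n.+1 * alpha n by field.
  by have := g_le n; lra.
elim=> [|n IHn].
  rewrite -(ler_pM2l (gamma_gt0 0%N)); apply: le_trans (below _) _.
  by rewrite g0 alpha0 mul0r subr0.
rewrite -(ler_pM2l (gamma_gt0 n.+1)); apply: le_trans (below _) _.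
have -> : gamma n.+1 * g n.+1 = 1 - alpha n.+1 / g n.
  by rewrite -(g_rec n) addrK.
by rewrite lerD2l lerN2 ler_wpM2l // lef_pV2 // posrE.
Qed.

(** * Turan's inequality for the normalized polynomials *)

Theorem theorem1 (R : realType) (alpha gamma : nat -> R)
    (p : nat -> {poly R})
    (alpha0 : alpha 0%N = 0)
    (p_rec : recurrence_polys alpha gamma p)
    (alpha_incr : increasing_seq alpha)
    (alpha_le : forall n : nat, alpha n <= 1 / 2)
    (gamma_gt0 : forall n : nat, 0 < gamma n)
    (gamma_decr : decreasing_seq gamma)
    (alpha_gamma : forall n : nat, alpha n + gamma n <= 1)
    (quotients : forall n : nat, (1 <= n)%N ->
       (alpha n - alpha n.-1) / (alpha n * gamma n.-1 - alpha n.-1 * gamma n)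
       <= (alpha n.+1 * gamma n - alpha n * gamma n.+1)
          / (gamma n - gamma n.+1))
    (initial : gamma 0%N - gamma 1%N <= alpha 1%N * gamma 0%N ^+ 2) :
  forall (n : nat) (x : R), (1 <= n)%N -> -1 <= x <= 1 ->
    0 <= normalized p n x ^+ 2 - normalized p n.-1 x * normalized p n.+1 x.
Proof.
move=> [//|n] x _ x_bounds; rewrite [n.+1.-1]/=.
case: p_rec => p0 p_rec.
have alpha_lt m : alpha m < alpha m.+1 by rewrite ltNge alpha_incr ltnn.
have gamma_lt m : gamma m.+1 < gamma m by rewrite ltNge gamma_decr ltnn.
have alpha_ge0 m : 0 <= alpha m by rewrite -alpha0 alpha_incr.
have horner_rec0 y : y = gamma 0%N * (p 1%N).[y].
  have /(congr1 (horner^~ y)) := p_rec 0%N.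
  by rewrite p0 /= scaler0 addr0 mulr1 hornerX hornerZ.
have horner_rec y m :
    y * (p m.+1).[y] = gamma m.+1 * (p m.+2).[y] + alpha m.+1 * (p m).[y].
  have /(congr1 (horner^~ y)) := p_rec m.+1.
  by rewrite /= mulrC hornerMX hornerD !hornerZ mulrC.
pose q m := (p m).[1].
have q0 : q 0%N = 1 by rewrite /q p0 hornerC.
have q_rec m : q m.+1 = gamma m.+1 * q m.+2 + alpha m.+1 * q m.
  by rewrite -horner_rec mul1r.
have q1 : gamma 0%N * q 1%N = 1 by rewrite -horner_rec0.
have q_incr := values_at1_incr alpha_ge0 gamma_gt0 alpha_gamma q0 q1 q_rec.
have q_gt0 m : 0 < q m by case/andP: (q_incr m).
have q_neq0 m : q m != 0 by rewrite gt_eqF.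
pose g m := q m.+1 / q m.
have g_gt0 m : 0 < g m by rewrite divr_gt0.
have g_ge1 m : 1 <= g m by rewrite ler_pdivlMr // mul1r; case/andP: (q_incr m).
have g0 : gamma 0%N * g 0%N = 1 by rewrite /g q0 divr1.
have g_rec m : gamma m.+1 * g m.+1 + alpha m.+1 / g m = 1.
  by rewrite /g invf_div !mulrA -mulrDl -q_rec divff.
have g_nonincr : forall m, g m.+1 <= g m.
  apply: (@ratios_nonincr _ alpha gamma) => //.
  by apply: ratio_le_quotient => // m; exact: (quotients m.+1).
apply: (@turan_ge0 _ (fun m => alpha m.+1 / g m) (normalized p ^~ x) x).
- by move=> m; rewrite divr_ge0 // ltW.
- by move=> m; rewrite ler_pM ?invr_ge0 ?lef_pV2 ?posrE // ltW.
- move=> m; apply: le_trans (alpha_le m.+1).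
  by rewrite ler_pdivrMr // ler_peMr.
- by rewrite ler_norml.
- rewrite /normalized -/(q 1%N) -/(q 0%N) q0 p0 hornerC divr1 mulr1.
  by apply: (mulfI (lt0r_neq0 (gamma_gt0 0%N)));
    rewrite mulrA -horner_rec0 -[X in X / _]mul1r -q1; field.
- move=> m; rewrite /normalized -!/(q _) mulrA horner_rec.
  rewrite -(g_rec m) addrK /g; field; rewrite !q_neq0 //.
Qed.
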